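(* (i) Let $n$ be a positive integer, and let $\zeta$ be a primitive $n$-th root of unity in a field $F$. Suppose that the characteristic of $F$ does not divide $n$. Then, for any $x\in F$ with $x^n\neq1$, we have $$\operatorname{per}\left[\frac1{1-\zeta^{j-k}x}\right]_{1\le j,k\le n}=\prod_{r=1}^n\left(\frac{nx^n}{1-x^n}+r\right).$$ (ii) For any prime $p\equiv3\pmod 4$, we have $$\operatorname{per}\left[\frac1{j^2+k^2}\right]_{1\le j,k\le (p-1)/2}\equiv\frac{(-1)^{(p+1)/4}}{4\left(\frac{p+1}{4}!\right)^2}\pmod p.$$
   Context: The permanent of an $N\times N$ matrix $A=[a_{j,k}]$ over a field is $\operatorname{per}(A)=\sum_{\tau\in S_N}\prod_{j=1}^{N}a_{j,\tau(j)}$. $\frac{p+1}{4}!$ means $((p+1)/4)!$. A congruence modulo $p$ between rational numbers with denominators prime to $p$ means that their difference, divided by $p$, is a rational number with denominator prime to $p$. *)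

(* Defs.v *)
From mathcomp Require Import all_boot all_order all_algebra all_fingroup.

Set Implicit Arguments.
Unset Strict Implicit.
Unset Printing Implicit Defensive.

Import GRing.Theory Num.Theory.
Local Open Scope ring_scope.

Definition permanent (R : comPzRingType) (N : nat) (A : 'M[R]_N) : R :=
  \sum_(tau : 'S_N) \prod_(j < N) A j (tau j).

Definition prime_to_den (p : nat) (a : rat) : bool := coprime p `|denq a|%N.

(* The relation is only meaningful between rationals whose denominators are
   prime to p, so this is made part of it. *)
Definition ratcong (p : nat) (a b : rat) : Prop :=
  [/\ prime_to_den p a, prime_to_den p b & prime_to_den p ((a - b) / p%:R)].

(* Main.v *)
Require Import Defs.
From mathcomp Require Import all_boot all_order all_algebra all_fingroup.
From mathcomp Require Import ring zify.

(** The permanent is computed as a quotient of two determinants. If a matrix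
    [A] has entries [A i j = 1 / (1 - s i * v j)] with distinct [v j], then
    Borchardt's identity holds: [\det A * permanent A] is the determinant of
    the matrix of the squares of the entries of [A] ([det_mul_permanent]).

    Let the [u j] be the [n] distinct [n]-th roots of unity, in any order, and
    take [s j = u j * x], [v k = (u k)^-1]. On the argument [t = u j / u k * x],
    which satisfies [t ^+ n = x ^+ n], both [1 / (1 - t)] and [1 / (1 - t) ^+ 2]
    are polynomials in [t] of degree less than [n], with explicit coefficients:
    [t ^+ i] gets [1 / (1 - x ^+ n)] in the first and [q + i + 1] times that in
    the second, where [q = n * x ^+ n / (1 - x ^+ n)]. A matrix with entries
    [\sum_i c i * (u j / u k) ^+ i] factors as Vandermonde, diagonal,
    Vandermonde, so its determinant is a fixed nonzero factor times
    [\prod_i c i] ([det_root_expansion]). In the quotient of the two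
    determinants everything cancels but [\prod_i (q + i + 1)]
    ([permanent_roots_of_unity]). The powers of a primitive root give the first
    claim.

    For the second claim, let [p = 4 m - 1] and [n = (p - 1) / 2 = 2 m - 1].
    Modulo [p], the squares of [1], ..., [n] are the [n]-th roots of unity. As
    [n] is odd, [x = -1] is allowed, and scaling the columns turns
    [1 / (1 - u j / u k * x)] into [1 / (u j + u k)]. Here [q = m] modulo [p],
    so the permanent is [(m + 1) ... (m + n)], and Wilson's theorem gives its
    value ([permanent_sum_squares]). As the denominators [j ^+ 2 + k ^+ 2]
    do not vanish modulo [p], the permanent over the rationals reduces to the
    permanent over the prime field ([reduces_to_permanent]), and two rationals
    with the same reduction are congruent ([reduces_to_ratcong]). *)

Set Implicit Arguments.
Unset Strict Implicit.
Unset Printing Implicit Defensive.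

Import GRing.Theory Num.Theory.

Local Open Scope ring_scope.

(** * Borchardt's identity *)

Lemma permanent_scale_cols (R : comPzRingType) (n : nat) (c : 'I_n -> R)
    (A : 'M[R]_n) :
  permanent (\matrix_(j, k) (c k * A j k)) = (\prod_k c k) * permanent A.
Proof.
rewrite /permanent mulr_sumr; apply: eq_bigr => s _.
rewrite [X in X * _](reindex_inj (@perm_inj _ s)) -big_split /=.
by apply: eq_bigr => j _; rewrite mxE.
Qed.

(** The product on the left is a double sum over permutations [s] and [t].
    Grouping its terms by the permutation [r] with [t = r \o s] gives the sum
    over [r] of the determinants of the matrices with entries
    [A i j * A i (r j)]. For [r = 1] this is the right-hand side. For any other
    [r], the columns of that matrix, weighted by [v j - v (r j)], sum to
    [\sum_j (B i j - B i (r j)) = 0]; as some weight is nonzero, the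
    determinant vanishes.

    The hypothesis on [B] is the partial fraction decomposition of
    [A i j * A i k]; it isolates what the argument uses of a Cauchy matrix and
    spares it all divisions. *)
Lemma det_mul_permanent (R : idomainType) (n : nat) (A B : 'M[R]_n)
    (v : 'I_n -> R) :
    injective v ->
    (forall i j k, A i j * A i k * (v j - v k) = B i j - B i k) ->
  \det A * permanent A = \det (\matrix_(i, j) A i j ^+ 2).
Proof.
move=> v_inj AB.
pose M (r : 'S_n) : 'M[R]_n := \matrix_(i, j) (A i j * A i (r j)).
have -> : \det A * permanent A = \sum_(r : 'S_n) \det (M r).
  rewrite /determinant /permanent mulr_suml exchange_big /=.
  apply: eq_bigr => s _; rewrite mulr_sumr (reindex_inj (mulgI s)) /=.
  apply: eq_bigr => r _; rewrite -mulrA -big_split /=; congr (_ * _).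
  by apply: eq_bigr => i _; rewrite mxE permM.
rewrite (bigD1 1%g) //= [X in _ + X]big1 ?addr0 => [|r r_neq1].
  by congr (\det _); apply/matrixP => i j; rewrite !mxE perm1 expr2.
apply/eqP; rewrite -det_tr; apply/det0P.
exists (\row_j (v j - v (r j))).
  apply: contra_neq r_neq1 => /rowP v0; apply/permP => j; apply: v_inj.
  by have /eqP := v0 j; rewrite !mxE subr_eq0 perm1 => /eqP.
apply/rowP => i; rewrite !mxE.
under eq_bigr do rewrite !mxE mulrC AB.
rewrite big_split sumrN /=.
by rewrite [X in X - _](reindex_inj (@perm_inj _ r)) subrr.
Qed.

(** * Permanents over the roots of unity *)

(** The same [D], the product of the determinants of two Vandermonde matrices,
    serves for all coefficients [c]: this is what makes it disappear from a
    quotient of two such determinants. *)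
Lemma det_root_expansion (F : fieldType) (n : nat) (u : 'I_n -> F) :
    injective u ->
  exists2 D : F, D != 0 & forall c : 'I_n -> F,
    \det (\matrix_(j, k) (\sum_i c i * (u j / u k) ^+ i)) = D * \prod_i c i.
Proof.
move=> u_inj.
have vdm_neq0 (w : 'I_n -> F) :
    injective w -> \det (Vandermonde n (\row_j w j)) != 0.
  move=> w_inj; rewrite det_Vandermonde.
  apply/prodf_neq0 => i _; apply/prodf_neq0 => j lt_ij; rewrite !mxE subr_eq0.
  by apply: contraTneq lt_ij => /w_inj ->; rewrite ltnn.
exists (\det (Vandermonde n (\row_j u j))
        * \det (Vandermonde n (\row_j (u j)^-1))).
  by rewrite mulf_neq0 // vdm_neq0 // => i j /invr_inj /u_inj.
move=> c; rewrite -det_tr mulrAC.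
have <- : \det (diag_mx (\row_i c i)) = \prod_i c i.
  by rewrite det_diag; apply: eq_bigr => i _; rewrite mxE.
rewrite -(det_tr (Vandermonde n (\row_j u j))) -!det_mulmx -det_tr.
congr (\det _); apply/matrixP => j k; rewrite !mxE; apply: eq_bigr => i _.
by rewrite mul_mx_diag !mxE exprMn; ring.
Qed.

(** The geometric series folded modulo [n]: [t ^+ n] occurs in the coefficients
    as a constant, because it takes the same value [x ^+ n] at all the entries
    of the matrix to which the expansion is applied. *)
Lemma inv_sub1_expansion (F : fieldType) (n : nat) (t : F) : t ^+ n != 1 ->
  (1 - t)^-1 = \sum_(i < n) (1 - t ^+ n)^-1 * t ^+ i.
Proof.
move=> tn_neq1; rewrite -mulr_sumr.
have t_neq1 : t != 1 by apply: contraNneq tn_neq1 => ->; rewrite expr1n.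
have geo : 1 - t ^+ n = (1 - t) * \sum_(i < n) t ^+ i.
  by rewrite -opprB subrX1 -mulNr opprB.
have : 1 - t ^+ n != 0 by rewrite subr_eq0 eq_sym.
rewrite geo; set S := \sum_(i < n) _; rewrite mulf_eq0 => /norP[t1 S0].
by field; rewrite t1 S0.
Qed.

(** The series [\sum_l (l + 1) * t ^+ l] folded in the same way. *)
Lemma inv_sub1_sqr_expansion (F : fieldType) (n : nat) (t : F) : t ^+ n != 1 ->
  (1 - t)^-1 ^+ 2 =
  \sum_(i < n)
    (1 - t ^+ n)^-1 * (n%:R * t ^+ n / (1 - t ^+ n) + i.+1%:R) * t ^+ i.
Proof.
move=> tn_neq1; under eq_bigr do rewrite mulrDr mulrDl.
rewrite big_split /=.
under eq_bigr do rewrite mulrAC; rewrite -mulr_suml -inv_sub1_expansion //.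
have t_neq1 : 1 - t != 0.
  by rewrite subr_eq0; apply: contraNneq tn_neq1 => <-; rewrite expr1n.
have q_neq0 : 1 - t ^+ n != 0 by rewrite subr_eq0 eq_sym.
under eq_bigr do rewrite -mulrA; rewrite -mulr_sumr.
have -> : \sum_(i < n) i.+1%:R * t ^+ i =
          ((1 - t ^+ n) / (1 - t) - n%:R * t ^+ n) / (1 - t).
  elim: (n) => [|m IHm].
    rewrite big_ord0 expr0 subrr !mul0r subr0.
    by rewrite mul0r.
  rewrite big_ord_recr /= IHm exprS -natr1.
  by field.
by field; rewrite t_neq1 q_neq0.
Qed.

(** The roots are given by an arbitrary enumeration, which lets the squares in
    a prime field be used without choosing a primitive root. *)
Lemma permanent_roots_of_unity (F : fieldType) (n : nat) (u : 'I_n -> F)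
    (x : F) :
    injective u -> (forall j, u j ^+ n = 1) -> x ^+ n != 1 ->
  permanent (\matrix_(j, k) (1 - u j / u k * x)^-1) =
  \prod_(i < n) (n%:R * x ^+ n / (1 - x ^+ n) + i.+1%:R).
Proof.
move=> u_inj u1 xn_neq1; set q := n%:R * _ / _.
have n_gt0 : (0 < n)%N by case: (n) xn_neq1 => //; rewrite expr0 eqxx.
(* For [x = 0] all the entries are 1; the determinant of the matrix is then
   zero when [1 < n], and cannot be divided out. *)
have [x0|x_neq0] := eqVneq x 0.
  have -> : q = 0 by rewrite /q x0 expr0n gtn_eqF // mulr0 mul0r.
  rewrite /permanent; under eq_bigr => s _.
    rewrite big1 => [|j _]; last by rewrite mxE x0 mulr0 subr0 invr1.
    over.
  rewrite sumr_const card_Sn fact_prod natr_prod big_add1 big_mkord.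
  by apply: eq_bigr => i _; rewrite add0r.
have tn j k : (u j / u k * x) ^+ n = x ^+ n.
  by rewrite exprMn expr_div_n !u1 divr1 mul1r.
have den_neq0 j k : 1 - u j / u k * x != 0.
  rewrite subr_eq0; apply: contraNneq xn_neq1 => t1.
  by rewrite -(tn j k) -t1 expr1n.
set A := \matrix_(j, k) _.
have [D D_neq0 detD] := det_root_expansion u_inj.
have detA : \det A = D * \prod_(i < n) ((1 - x ^+ n)^-1 * x ^+ i).
  rewrite -detD; congr (\det _); apply/matrixP => j k; rewrite !mxE.
  rewrite (inv_sub1_expansion (n := n)) tn //.
  by apply: eq_bigr => i _; rewrite exprMn; ring.
have detA2 : \det (\matrix_(j, k) A j k ^+ 2) =
    D * \prod_(i < n) ((1 - x ^+ n)^-1 * x ^+ i * (q + i.+1%:R)).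
  rewrite -detD; congr (\det _); apply/matrixP => j k; rewrite !mxE.
  rewrite (inv_sub1_sqr_expansion (n := n)) tn //.
  by apply: eq_bigr => i _; rewrite exprMn -/q; ring.
have detA_neq0 : \det A != 0.
  rewrite detA mulf_neq0 //; apply/prodf_neq0 => i _.
  by rewrite mulf_neq0 ?expf_neq0 // invr_neq0 // subr_eq0 eq_sym.
apply: (mulfI detA_neq0).
rewrite (det_mul_permanent
  (B := \matrix_(j, k) ((u k)^-1 * (1 - u j / u k * x)^-1))
  (v := fun k => (u k)^-1)).
- by rewrite detA2 detA big_split mulrA.
- by move=> j k /invr_inj /u_inj.
move=> i j k; rewrite !mxE.
have u_neq0 l : u l != 0.
  apply: contra_eq_neq (u1 l) => ->.
  by rewrite expr0n gtn_eqF // eq_sym oner_eq0.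
have := den_neq0 i j; have := den_neq0 i k.
set a := (u j)^-1; set b := (u k)^-1 => nzb nza.
by field; rewrite nza nzb.
Qed.

(** * The permanent modulo p *)

Lemma natr_pchar_inj (R : nzRingType) (p a b : nat) : p \in [pchar R] ->
  (a < p)%N -> (b < p)%N -> a%:R = b%:R :> R -> a = b.
Proof.
move=> pR; wlog le_ab : a b / (a <= b)%N.
  move=> th ap bp ab.
  by case: (leqP a b) => [|/ltnW] le; [|symmetry]; apply: th.
move=> _ b_ltp ab; apply/eqP; rewrite eqn_leq le_ab /= -subn_eq0.
apply: contraLR b_ltp; rewrite -lt0n -leqNgt => ba_gt0.
apply: leq_trans (leq_subr a b); apply: dvdn_leq => //.
by rewrite (dvdn_pcharf pR) natrB // ab subrr.
Qed.

(** Wilson's theorem is the case [a = 0]. Moving one unit from [b.+1] to [a]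
    replaces the factor [b.+1] by [a.+1], its opposite since their sum is [p]. *)
Lemma Wilson_pchar (F : fieldType) (p a b : nat) : p \in [pchar F] ->
  (a + b).+1 = p -> a`!%:R * b`!%:R = (-1) ^+ a.+1 :> F.
Proof.
move=> pF; have p_pr := pcharf_prime pF.
elim: a b => [|a IHa] b.
  rewrite add0n mul1r expr1 => bp; apply/eqP.
  rewrite -addr_eq0 natr1 -(dvdn_pcharf pF).
  by have := Wilson (prime_gt1 p_pr); rewrite p_pr -bp => <-.
rewrite addSnnS => abp; rewrite exprS -(IHa _ abp) !factS !natrM.
suff -> : b.+1%:R = - a.+1%:R :> F by ring.
by apply/eqP; rewrite -addr_eq0 -natrD addnC addSn abp -(dvdn_pcharf pF).
Qed.

Lemma natr_pchar_neq0 (R : nzRingType) (p a : nat) : p \in [pchar R] ->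
  (0 < a < p)%N -> a%:R != 0 :> R.
Proof.
move=> pR /andP[a_gt0 a_ltp]; rewrite -(dvdn_pcharf pR).
by apply: contraL a_ltp => /dvdn_leq; rewrite -leqNgt; apply.
Qed.

Lemma fact_pchar_neq0 (R : idomainType) (p m : nat) : p \in [pchar R] ->
  (m < p)%N -> m`!%:R != 0 :> R.
Proof.
move=> pR m_ltp; rewrite fact_prod natr_prod big_add1 big_mkord.
apply/prodf_neq0 => i _; apply: (natr_pchar_neq0 pR).
by rewrite /= (leq_ltn_trans (ltn_ord i)).
Qed.

(** By Fermat's little theorem: the exponent of [a] is [p.-1]. *)
Lemma sqr_natr_expr_half (F : fieldType) (p n a : nat) : p \in [pchar F] ->
  n.*2.+1 = p -> (0 < a < p)%N -> (a%:R ^+ 2) ^+ n = 1 :> F.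
Proof.
move=> pF n2p a_bnd; apply: (mulfI (natr_pchar_neq0 pF a_bnd)).
rewrite -exprM -exprS mul2n n2p mulr1.
by rewrite -(pFrobenius_autE pF) pFrobenius_aut_nat.
Qed.

(** Otherwise -1 would be a quotient of two squares, and its [n]-th power, which
    is -1, would be 1. *)
Lemma sum_squares_neq0 (F : fieldType) (p n a b : nat) : p \in [pchar F] ->
    n.*2.+1 = p -> odd n -> (0 < a < p)%N -> (0 < b < p)%N ->
  a%:R ^+ 2 + b%:R ^+ 2 != 0 :> F.
Proof.
move=> pF n2p n_odd a_bnd b_bnd; rewrite addr_eq0; apply/eqP => ab.
have two_neq0 : 2%:R != 0 :> F.
  by apply: (natr_pchar_neq0 pF); case: (n) n_odd n2p => // l _ <-.
have := sqr_natr_expr_half pF n2p a_bnd.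
rewrite ab exprNn (sqr_natr_expr_half pF n2p b_bnd) -signr_odd n_odd.
move/eqP; rewrite expr1 mulr1 eq_sym -addr_eq0 -(natrD _ 1 1).
by rewrite (negPf two_neq0).
Qed.

(** The case [x = -1] of [permanent_roots_of_unity] for the squares of
    [1], ..., [n]. It gives [(m + n)`! / m`!]; since [(m + n) + m.-1 = p.-1],
    Wilson's theorem turns this into [(-1) ^+ m / (m`! * m.-1`!)], and
    [m.-1`! = 4 * m`!] because [4 * m = 1]. *)
Lemma permanent_sum_squares (F : fieldType) (p m n : nat) : p \in [pchar F] ->
    p.+1 = (4 * m)%N -> n.+1 = (2 * m)%N ->
  permanent (\matrix_(j < n, k < n) (j.+1%:R ^+ 2 + k.+1%:R ^+ 2)^-1) =
  (-1) ^+ m / (4%:R * m`!%:R ^+ 2) :> F.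
Proof.
move=> pF p4m n2m.
have small_neq0 a : (0 < a < p)%N -> a%:R != 0 :> F.
  exact: natr_pchar_neq0 pF.
have p_pr := pcharf_prime pF; have p_gt1 := prime_gt1 p_pr.
have N1n : (-1) ^+ n = -1 :> F.
  by rewrite -signr_odd (_ : odd n) ?expr1 //; lia.
have two_neq0 : 2%:R != 0 :> F by apply: small_neq0; lia.
have four_m : 4%:R * m%:R = 1 :> F.
  by rewrite -natrM -p4m -natr1 (pcharf0 pF) add0r.
pose u (j : 'I_n) : F := j.+1%:R ^+ 2.
have u_neq0 j : u j != 0.
  by rewrite expf_neq0 // small_neq0 //; have := ltn_ord j; lia.
have u1 j : u j ^+ n = 1.
  by apply: (sqr_natr_expr_half pF); have := ltn_ord j; lia.
have u_inj : injective u.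
  move=> j k /eqP; rewrite eqf_sqr => /orP[] /eqP.
    move=> jk; apply: val_inj; apply: succn_inj.
    by apply: (natr_pchar_inj pF _ _ jk);
      have := ltn_ord j; have := ltn_ord k; lia.
  move=> /eqP; rewrite -addr_eq0 -natrD (negPf (small_neq0 _ _)) //.
  by have := ltn_ord j; have := ltn_ord k; lia.
(* The product of the squares is [n`! ^+ 2], which Wilson's theorem evaluates
   as [(-1) ^+ n.+1]. *)
have prod_u : \prod_k (u k)^-1 = 1.
  rewrite prodfV prodrXl.
  have -> : \prod_(k < n) k.+1%:R = n`!%:R :> F.
    by rewrite fact_prod natr_prod big_add1 big_mkord.
  by rewrite expr2 (Wilson_pchar pF) ?n2m ?exprM ?sqrrN ?expr1n ?invr1 //; lia.
transitivity (\prod_(i < n) (m%:R + i.+1%:R) : F).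
  have N1n_neq1 : (-1) ^+ n != 1 :> F.
    by rewrite N1n eq_sym -subr_eq0 opprK -(natrD _ 1 1).
  have -> : \prod_(i < n) (m%:R + i.+1%:R) =
      \prod_(i < n) (n%:R * (-1) ^+ n / (1 - (-1) ^+ n) + i.+1%:R) :> F.
    apply: eq_bigr => i _; congr (_ + _); rewrite N1n opprK.
    (* The quotient is [- n / 2], and [n + 2 * m = p]. *)
    have -> : n%:R = - (2%:R * m%:R) :> F.
      apply/eqP; rewrite -addr_eq0 -natrM -natrD.
      by have -> : (n + 2 * m = p)%N; [lia | rewrite (pcharf0 pF)].
    by field.
  rewrite -(permanent_roots_of_unity (u := u)) // -[RHS]mul1r.
  rewrite -[X in X * _]prod_u -permanent_scale_cols; congr permanent.
  apply/matrixP => j k; rewrite !mxE -invfM mulrN1 opprK mulrDr mulr1.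
  by rewrite mulrCA divff // mulr1 addrC.
have rising : m`!%:R * \prod_(i < n) (m%:R + i.+1%:R) = (m + n)`!%:R :> F.
  elim: (n) => [|l IHl]; first by rewrite big_ord0 addn0 mulr1.
  by rewrite big_ord_recr mulrA IHl addnS factS natrM mulrC -natrD addnS.
have fact_neq0 : m`!%:R != 0 :> F by apply: (fact_pchar_neq0 pF); lia.
have wilson : (m + n)`!%:R * m.-1`!%:R = (-1) ^+ m :> F.
  rewrite (Wilson_pchar pF) //; last by lia.
  have -> : (m + n).+1 = (m + 2 * m)%N by lia.
  by rewrite exprD exprM sqrrN !expr1n mulr1.
have fact_m : m`!%:R = m%:R * m.-1`!%:R :> F.
  by rewrite -natrM; case: (m) n2m.
have four_neq0 : 4%:R != 0 :> F by rewrite (natrM _ 2 2) mulf_neq0.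
apply: (mulIf (mulf_neq0 four_neq0 (expf_neq0 2 fact_neq0))).
rewrite divfK; last by rewrite mulf_neq0 ?expf_neq0.
rewrite -wilson -rising.
set P := \prod_(i < n) _.
transitivity ((4%:R * m%:R) * (m`!%:R * P * m.-1`!%:R)).
  by rewrite expr2 {2}fact_m; ring.
by rewrite four_m mul1r.
Qed.

(** * Reduction of rational numbers modulo p *)

(** The reduction map is partial, being defined only on the rationals with
    invertible denominator; as a relation it needs neither a localization nor a
    fraction in lowest terms. *)
Definition reduces_to (F : fieldType) (a : rat) (c : F) : Prop :=
  exists m d : int,
    [/\ d%:~R != 0 :> F, a = m%:~R / d%:~R & c = m%:~R / d%:~R].

Lemma intr_rat_neq0 (F : fieldType) (d : int) :
  d%:~R != 0 :> F -> d%:~R != 0 :> rat.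
Proof. by rewrite intr_eq0; apply: contra_neq => ->. Qed.

Lemma reduces_to_int (F : fieldType) (m : int) :
  reduces_to m%:~R (m%:~R : F).
Proof. by exists m, 1; rewrite !divr1 oner_neq0. Qed.

Lemma reduces_to_nat (F : fieldType) (m : nat) : reduces_to m%:R (m%:R : F).
Proof. exact: reduces_to_int F m. Qed.

Lemma reduces_toD (F : fieldType) (a b : rat) (c e : F) :
  reduces_to a c -> reduces_to b e -> reduces_to (a + b) (c + e).
Proof.
move=> [m [d [d0 -> ->]]] [m' [d' [d'0 -> ->]]].
have d0Q := intr_rat_neq0 d0; have d'0Q := intr_rat_neq0 d'0.
exists (m * d' + m' * d), (d * d'); rewrite intrM mulf_neq0 //.
by rewrite !(intrM, intrD); split; rewrite ?addf_div.
Qed.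

Lemma reduces_toM (F : fieldType) (a b : rat) (c e : F) :
  reduces_to a c -> reduces_to b e -> reduces_to (a * b) (c * e).
Proof.
move=> [m [d [d0 -> ->]]] [m' [d' [d'0 -> ->]]].
exists (m * m'), (d * d'); rewrite intrM mulf_neq0 //.
by rewrite !intrM; split; rewrite ?mulf_div.
Qed.

Lemma reduces_toX (F : fieldType) (a : rat) (c : F) (n : nat) :
  reduces_to a c -> reduces_to (a ^+ n) (c ^+ n).
Proof.
move=> ac; elim: n => [|n IHn]; first exact: reduces_to_int F 1.
by rewrite !exprS; apply: reduces_toM.
Qed.

Lemma reduces_toV (F : fieldType) (a : rat) (c : F) :
  c != 0 -> reduces_to a c -> reduces_to a^-1 c^-1.
Proof.
move=> c_neq0 [m [d [d0 -> def_c]]]; exists d, m.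
split; rewrite ?def_c ?invf_div //.
by apply: contraNneq c_neq0; rewrite def_c => ->; rewrite mul0r.
Qed.

Lemma reduces_to_permanent (F : fieldType) (n : nat) (A : 'M[rat]_n)
    (C : 'M[F]_n) :
    (forall j k, reduces_to (A j k) (C j k)) ->
  reduces_to (permanent A) (permanent C).
Proof.
move=> AC; apply: (big_ind2 (@reduces_to F)) => [|a c b e|s _].
- exact: reduces_to_int F 0.
- exact: reduces_toD.
apply: (big_ind2 (@reduces_to F)) => [|a c b e|j _].
- exact: reduces_to_int F 1.
- exact: reduces_toM.
exact: AC.
Qed.

(** The fraction need not be in lowest terms: from [numq a * d = m * denq a], a
    prime dividing [denq a] divides [numq a * d], hence [d]. *)
Lemma prime_to_den_frac (p : nat) (m d : int) : prime p ->
  ~~ (p %| d)%Z -> prime_to_den p (m%:~R / d%:~R).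
Proof.
move=> p_pr pNd; rewrite /prime_to_den prime_coprime //; set a : rat := _ / _.
have d_neq0 : d%:~R != 0 :> rat.
  by rewrite intr_eq0; apply: contraNneq pNd => ->; rewrite dvdz0.
apply: contra pNd => p_den.
have eq_md : numq a * d = m * denq a.
  by apply: (@intr_inj rat); rewrite !intrM numqE mulrAC divfK.
have : (p %| `|numq a| * `|d|)%N by rewrite -abszM eq_md abszM dvdn_mull.
rewrite Euclid_dvdM // => /orP[p_num|//].
have := coprime_num_den a; rewrite /coprime => /eqP num_den.
have : (p %| 1)%N by rewrite -num_den dvdn_gcd p_num.
by rewrite dvdn1 gtn_eqF // prime_gt1.
Qed.

Lemma reduces_to_ratcong (F : fieldType) (p : nat) (a b : rat) (c : F) :
  p \in [pchar F] -> reduces_to a c -> reduces_to b c -> ratcong p a b.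
Proof.
move=> pF [m [d [d0 -> ->]]] [m' [d' [d'0 -> eq_c]]].
have p_pr := pcharf_prime pF.
have d0Q := intr_rat_neq0 d0; have d'0Q := intr_rat_neq0 d'0.
have pNd : ~~ (p %| d)%Z by rewrite (dvdz_pcharf pF).
have pNd' : ~~ (p %| d')%Z by rewrite (dvdz_pcharf pF).
split; try exact: prime_to_den_frac.
have /dvdzP[t def_t] : (p %| m * d' - m' * d)%Z.
  rewrite (dvdz_pcharf pF) intrB !intrM subr_eq0.
  by move/eqP: eq_c; rewrite eqr_div.
have p0 : p%:R != 0 :> rat by rewrite pnatr_eq0 -lt0n prime_gt0.
have -> : (m%:~R / d%:~R - m'%:~R / d'%:~R) / p%:R =
          t%:~R / (d * d')%:~R :> rat.
  rewrite -mulNr addf_div // mulNr -!intrM -intrB def_t intrM.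
  by rewrite mulrAC mulfK.
by apply: prime_to_den_frac => //; rewrite (dvdz_pcharf pF) intrM mulf_neq0.
Qed.

Theorem theorem3 :
  (forall (n : nat) (F : fieldType) (zeta : F),
     (0 < n)%N ->
     n.-primitive_root zeta ->
     (forall q : nat, q \in [pchar F] -> ~~ (q %| n)%N) ->
     forall x : F, x ^+ n != 1 ->
       permanent (\matrix_(j < n, k < n)
                    (1 / (1 - zeta ^ (Posz j.+1 - Posz k.+1) * x)))
       = \prod_(1 <= r < n.+1) (n%:R * x ^+ n / (1 - x ^+ n) + r%:R))
  /\
  (forall p : nat, prime p -> p = 3 %[mod 4] ->
     ratcong p
       (permanent (\matrix_(j < (p - 1) %/ 2, k < (p - 1) %/ 2)
                     (1 / ((j.+1)%:R ^+ 2 + (k.+1)%:R ^+ 2) : rat)))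
       ((-1) ^+ ((p + 1) %/ 4) / (4%:R * (((p + 1) %/ 4)`!)%:R ^+ 2))).
Proof.
split=> [n F zeta n_gt0 zeta_prim _ x xn_neq1 | p p_pr p_mod4].
  have zeta_neq0 : zeta != 0.
    apply: contra_eq_neq (prim_expr_order zeta_prim) => ->.
    by rewrite expr0n gtn_eqF // eq_sym oner_eq0.
  pose u (j : 'I_n) := zeta ^+ j.+1.
  have u_inj : injective u.
    move=> j k; rewrite /u !exprS => /(mulfI zeta_neq0)/eqP.
    rewrite (eq_prim_root_expr zeta_prim) !modn_small // => /eqP.
    exact: val_inj.
  have u1 j : u j ^+ n = 1.
    by rewrite exprAC (prim_expr_order zeta_prim) expr1n.
  rewrite big_add1 big_mkord -(permanent_roots_of_unity (u := u)) //.
  congr permanent; apply/matrixP => j k; rewrite !mxE mul1r.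
  by rewrite expfzDr // exprnN.
have pF := pchar_Fp p_pr.
have p_gt1 := prime_gt1 p_pr.
set m := ((p + 1) %/ 4)%N; set n := ((p - 1) %/ 2)%N.
have p4m : p.+1 = (4 * m)%N by rewrite /m; lia.
have n2m : n.+1 = (2 * m)%N by rewrite /n; lia.
have fact_neq0 : m`!%:R != 0 :> 'F_p by apply: (fact_pchar_neq0 pF); lia.
have four_neq0 : 4%:R != 0 :> 'F_p.
  by rewrite (natrM _ 2 2) mulf_neq0 // (natr_pchar_neq0 pF) //; lia.
apply: (reduces_to_ratcong (c := (-1) ^+ m / (4%:R * m`!%:R ^+ 2)) pF).
  rewrite -(permanent_sum_squares pF p4m n2m).
  apply: reduces_to_permanent => j k; rewrite !mxE div1r.
  apply: reduces_toV.
    by apply: (sum_squares_neq0 (n := n) pF);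
      have := ltn_ord j; have := ltn_ord k; lia.
  by apply: reduces_toD; apply: reduces_toX; apply: reduces_to_nat.
apply: reduces_toM; first by apply: reduces_toX; apply: (reduces_to_int _ (-1)).
apply: reduces_toV; first by rewrite mulf_neq0 ?expf_neq0.
apply: reduces_toM; first exact: reduces_to_nat.
by apply: reduces_toX; apply: reduces_to_nat.
Qed.
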